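(* Let $L>0$, $n\in\mathbb N$, $h=L/n$, and let $\Omega=[0,L]^3$ be divided into the tetrahedra $T_i^\alpha$ described in the context, with matrices $M^i$ as defined there. Let $u:\mathbb R^3\to\mathbb R^3$ be a continuous vector field, $L$-periodic in each variable (a velocity field at a fixed time), let $Iu$ be its piecewise linear interpolant and let $D^{\alpha,i}(u)$ be the associated difference-quotient matrices, as defined in the context. Then for every $\alpha$ and $i$, $\nabla Iu(x)=D^{\alpha,i}(u)\,M^i$ for $x$ in the interior of $T_i^\alpha$, where $(\nabla Iu)_{l,j}=\partial_j (Iu)_l$, and $$\|M^{-1}\|_{L^\infty}^{-2}\sum_{\alpha}\sum_{i=1}^5\|D^{\alpha,i}(u)\|_{L^2}^2\ \le\ \|\nabla Iu\|_{L^2}^2\ \le\ \|M\|_{L^\infty}^{2}\sum_{\alpha}\sum_{i=1}^5\|D^{\alpha,i}(u)\|_{L^2}^2 .$$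
   Context: Subdivision. $\Omega$ is divided into $n^3$ cubes $Q_\alpha$ of side $h$ in the uniform grid, $\alpha=(j,k,l)$, $1\le j,k,l\le n$. Each cube, written as $q_\alpha+h[0,1]^3$, is subdivided into five tetrahedra $T_i^\alpha=q_\alpha+hS_i$, $i=1,\dots,5$, where the $S_i$ are the convex hulls of $S_1:\{(0,0,0),(1,0,0),(0,1,0),(0,0,1)\}$; $S_2:\{(1,0,0),(0,1,0),(0,0,1),(1,1,1)\}$; $S_3:\{(1,0,0),(0,1,0),(1,1,0),(1,1,1)\}$; $S_4:\{(1,0,0),(0,0,1),(1,0,1),(1,1,1)\}$; $S_5:\{(0,1,0),(0,0,1),(0,1,1),(1,1,1)\}$. For each $i$ fix an ordering of the vertices of $S_i$, and let $v_1^{\alpha,i},\dots,v_4^{\alpha,i}$ be the correspondingly ordered vertices of $T_i^\alpha$. The edge vectors $w_k^i=v_k^{\alpha,i}-v_4^{\alpha,i}$, $k=1,2,3$, do not depend on $\alpha$ and are linearly independent. Interpolant. For $x$ in the interior of $T_i^\alpha$ with $x=\sum_{k=1}^4a_kv_k^{\alpha,i}$, $0\le a_k\le1$, $\sum_{k=1}^4a_k=1$, set $\mathcal Iu(x)=\sum_{k=1}^4a_k\,u(v_k^{\alpha,i})$. Define $Iu(x)=\mathcal Iu(x)-\frac1{L^3}\int_\Omega\mathcal Iu(y)\,dy$. The gradient $\nabla Iu$ is the one computed inside each tetrahedron, and $\|\nabla Iu\|_{L^2}^2=\sum_{\alpha,i}\int_{T_i^\alpha}|\nabla Iu|^2dx$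 with $|\cdot|$ the Frobenius norm of a matrix. Matrices. With $\widehat w_k^i=w_k^i/|w_k^i|$ and $e_1,e_2,e_3$ the standard basis of $\mathbb R^3$, $M^i$ is the invertible $3\times3$ matrix determined by $[e_1,e_2,e_3]=[\widehat w_1^i,\widehat w_2^i,\widehat w_3^i]\,M^i$; it does not depend on $\alpha$ or $h$. $M$ denotes the piecewise constant matrix function equal to $M^i$ on $T_i^\alpha$, and $\|M\|_{L^\infty}=\max_{1\le i\le5}\|M^i\|$, $\|M^{-1}\|_{L^\infty}=\max_{1\le i\le5}\|(M^i)^{-1}\|$, where $\|\cdot\|$ is the Euclidean operator norm. The matrix $D^{\alpha,i}(u)$ has entries $$D^{\alpha,i}_{l,k}(u)=\frac{u_l(v_k^{\alpha,i})-u_l(v_4^{\alpha,i})}{|v_k^{\alpha,i}-v_4^{\alpha,i}|},\qquad l,k=1,2,3,$$ and is regarded as a constant matrix function on $T_i^\alpha$, so that $\|D^{\alpha,i}(u)\|_{L^2}^2=|T_i^\alpha|\sum_{l,k}|D_{l,k}^{\alpha,i}(u)|^2$, where $|T_i^\alpha|$ is the volume of $T_i^\alpha$. *)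

(* Defs.v *)
From HB Require Import structures.
From mathcomp Require Import all_boot all_order all_algebra all_fingroup.
From mathcomp Require Import lra.
From mathcomp Require Import all_classical all_reals all_analysis.

Set Implicit Arguments.
Unset Strict Implicit.
Unset Printing Implicit Defensive.

Import Order.TTheory GRing.Theory Num.Theory.
Import numFieldNormedType.Exports.
Local Open Scope classical_set_scope.
Local Open Scope ring_scope.

Section MatrixNorms.
Variable R : realType.

(* The library norm on matrices is the max norm, hence the two norms below.
   On row and column vectors the Frobenius norm is the Euclidean norm. *)
Definition frobenius m n (A : 'M[R]_(m, n)) : R :=
  Num.sqrt (\sum_i \sum_j A i j ^+ 2).

Definition opnorm m n (A : 'M[R]_(m, n)) : R :=
  sup [set frobenius (A *m x) | x in [set x : 'cV[R]_n | frobenius x <= 1]].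

End MatrixNorms.

Section Lebesgue3.
Variable R : realType.

(* The library has no measurable structure on row vectors: R^3 is carried as
   R * R * R for integration, and as 'rV_3 for topology and differentiation. *)
Definition R3 : Type :=
  (measurableTypeR R * measurableTypeR R * measurableTypeR R)%type.

Definition vec3 (p : R3) : 'rV[R]_3 :=
  \row_(j < 3) nth 0 [:: p.1.1; p.1.2; p.2] j.

Definition leb3 : {measure set R3 -> \bar R} :=
  ((@lebesgue_measure R \x @lebesgue_measure R) \x @lebesgue_measure R)%E.

End Lebesgue3.

Section Subdivision.
Variable R : realType.

(* Vertices of S_1, ..., S_5 (indexed from 0). *)
Definition ref_table : seq (seq (seq nat)) :=
  [:: [:: [:: 0; 0; 0]; [:: 1; 0; 0]; [:: 0; 1; 0]; [:: 0; 0; 1]];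
      [:: [:: 1; 0; 0]; [:: 0; 1; 0]; [:: 0; 0; 1]; [:: 1; 1; 1]];
      [:: [:: 1; 0; 0]; [:: 0; 1; 0]; [:: 1; 1; 0]; [:: 1; 1; 1]];
      [:: [:: 1; 0; 0]; [:: 0; 0; 1]; [:: 1; 0; 1]; [:: 1; 1; 1]];
      [:: [:: 0; 1; 0]; [:: 0; 0; 1]; [:: 0; 1; 1]; [:: 1; 1; 1]]]%N.

Definition ref_vertex (i : 'I_5) (k : 'I_4) : 'rV[R]_3 :=
  \row_(j < 3) (nth 0 (nth [::] (nth [::] ref_table i) k) j)%N%:R.

Lemma ref_vertex_free (i : 'I_5) (d : 'I_4 -> R) :
  \sum_m d m = 0 -> \sum_m d m *: ref_vertex i m = 0 -> forall m, d m = 0.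
Proof.
move=> + /matrixP dS.
have := (dS ord0 (inord 0), dS ord0 (inord 1), dS ord0 (inord 2)).
rewrite !summxE !big_ord_recl !big_ord0 !mxE !inordK //=.
rewrite !(addr0, mulr0, mulr1, add0r).
case: i dS => -[|[|[|[|[|//]]]]] ? _ /=;
  rewrite !(addr0, mulr0, mulr1, add0r);
  move=> [[d0 d1] d2] ds -[[|[|[|[|//]]]] m4];
  (rewrite (_ : Ordinal m4 = ord0); last exact: val_inj) ||
  (rewrite (_ : Ordinal m4 = lift ord0 ord0); last exact: val_inj) ||
  (rewrite (_ : Ordinal m4 = lift ord0 (lift ord0 ord0)); last exact: val_inj)
  || (rewrite (_ : Ordinal m4 = lift ord0 (lift ord0 (lift ord0 ord0)));
      last exact: val_inj);
  lra.
Qed.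

Definition convex_hull (m : nat) (p : 'I_m -> 'rV[R]_3) : set 'rV[R]_3 :=
  [set x | exists a : 'I_m -> R,
    [/\ forall k, 0 <= a k, \sum_k a k = 1 & x = \sum_k a k *: p k]].

Variables (L : R) (n : nat).

Definition step : R := L / n%:R.

Definition Omega : set 'rV[R]_3 := [set x | forall j, 0 <= x ord0 j <= L].

(* Cube indices are triples over {0, ..., n - 1} instead of {1, ..., n}. *)
Definition corner (alpha : {ffun 'I_3 -> 'I_n}) : 'rV[R]_3 :=
  step *: \row_(j < 3) (alpha j)%:R.

Definition tetra (alpha : {ffun 'I_3 -> 'I_n}) (i : 'I_5) : set 'rV[R]_3 :=
  [set corner alpha + step *: y | y in convex_hull (ref_vertex i)].

(* s i is the chosen ordering of the vertices of S_i. *)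
Variable s : 'I_5 -> {perm 'I_4}.

Definition vertex (alpha : {ffun 'I_3 -> 'I_n}) (i : 'I_5) (k : 'I_4)
    : 'rV[R]_3 :=
  corner alpha + step *: ref_vertex i (s i k).

(* The first three vertices are indexed by lift ord_max : 'I_3 -> 'I_4 and the
   fourth one by ord_max. *)
Definition edge (i : 'I_5) (k : 'I_3) : 'rV[R]_3 :=
  step *: ref_vertex i (s i (lift ord_max k))
    - step *: ref_vertex i (s i ord_max).

Lemma edgeE alpha i k :
  vertex alpha i (lift ord_max k) - vertex alpha i ord_max = edge i k.
Proof. by rewrite /vertex /edge opprD addrACA subrr add0r. Qed.

(* Column k is the k-th normalised edge vector. *)
Definition unit_edges (i : 'I_5) : 'M[R]_3 :=
  \matrix_(l, k) (edge i k ord0 l / frobenius (edge i k)).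

(* Since [e_1, e_2, e_3] is the identity matrix, M^i is the inverse of
   unit_edges i; see mul_unit_edges_Mmx. *)
Definition Mmx (i : 'I_5) : 'M[R]_3 := invmx (unit_edges i).

Hypotheses (L_gt0 : 0 < L) (n_gt0 : (0 < n)%N).

Let step_neq0 : step != 0.
Proof. by rewrite mulf_neq0 ?invr_neq0 ?pnatr_eq0 ?gt_eqF -?lt0n. Qed.

Lemma edges_free i (c : 'I_3 -> R) :
  \sum_k c k *: edge i k = 0 -> forall k, c k = 0.
Proof.
move=> cw k.
pose d m := if unlift ord_max ((s i)^-1%g m) is Some j then c j
            else - \sum_j c j.
have dl j : d (s i (lift ord_max j)) = c j by rewrite /d permK liftK.
have dm : d (s i ord_max) = - \sum_j c j by rewrite /d permK unlift_none.
rewrite -dl; apply: (@ref_vertex_free i).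
  rewrite (reindex_inj (@perm_inj _ (s i))) (bigD1 ord_max) //= dm.
  rewrite (reindex_onto (lift ord_max) (fun m => odflt k (unlift ord_max m))).
    rewrite addrC; apply/eqP; rewrite subr_eq0; apply/eqP.
    by apply: eq_big => [j|j _]; rewrite ?liftK ?eqxx ?dl // eq_sym neq_lift.
  by move=> m m_max; case: unliftP m_max => [j ->|->]; rewrite ?eqxx.
rewrite (reindex_inj (@perm_inj _ (s i))) (bigD1 ord_max) //= dm.
rewrite (reindex_onto (lift ord_max) (fun m => odflt k (unlift ord_max m)));
  last by move=> m m_max; case: unliftP m_max => [j ->|->]; rewrite ?eqxx.
rewrite (eq_big xpredT (fun j => c j *: ref_vertex i (s i (lift ord_max j))));
  last first.
- by move=> j _; rewrite dl.
- by move=> j; rewrite liftK eqxx eq_sym neq_lift.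
apply: (scalerI step_neq0); rewrite scaler0 -[RHS]cw.
rewrite scalerDr !scaler_sumr scaleNr scaler_suml scalerN scaler_sumr addrC.
rewrite -sumrB; apply: eq_bigr => j _.
by rewrite /edge scalerBr !scalerA ![step * _]mulrC.
Qed.

Lemma mul_unit_edges_Mmx i : 1%:M = unit_edges i *m Mmx i.
Proof.
rewrite mulmxV // -unitmx_tr -row_free_unit; apply: inj_row_free => v vW0.
have edge_neq0 k : frobenius (edge i k) != 0.
  apply/negP; rewrite sqrtr_eq0 big_ord1 => w0.
  have : \sum_(j < 3) edge i k ord0 j ^+ 2 == 0.
    by rewrite eq_le w0 sumr_ge0 // => j _; exact: sqr_ge0.
  rewrite psumr_eq0 => [/allP w0j|j _]; last exact: sqr_ge0.
  have {}w0 : edge i k = 0.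
    apply/rowP => j; rewrite [RHS]mxE; apply/eqP; rewrite -sqrf_eq0.
    by apply: w0j; rewrite mem_index_enum.
  suff /edges_free/(_ k)/eqP : \sum_j (j == k)%:R *: edge i j = 0.
    by rewrite eqxx oner_eq0.
  rewrite big1 // => j _; case: eqVneq => [->|_]; last by rewrite scale0r.
  by rewrite w0 scaler0.
apply/rowP => k; rewrite [RHS]mxE.
suff /eqP : v ord0 k / frobenius (edge i k) = 0.
  by rewrite mulf_eq0 invr_eq0 (negbTE (edge_neq0 k)) orbF => /eqP.
apply: (@edges_free i (fun k => v ord0 k / frobenius (edge i k))).
apply/rowP => l; move/rowP/(_ l): vW0; rewrite !mxE => vW0.
rewrite summxE -[RHS]vW0; apply: eq_bigr => j _.
by rewrite !mxE mulrAC -mulrA mulrC mulrAC mulrC mulrA.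
Qed.

Definition M_Linfty : R := \big[Num.max/0]_(i < 5) opnorm (Mmx i).

Definition Minv_Linfty : R := \big[Num.max/0]_(i < 5) opnorm (invmx (Mmx i)).

Variable u : 'rV[R]_3 -> 'rV[R]_3.

(* The tetrahedra have disjoint interiors, so that the set below has at most one
   element; the value outside of these interiors is 0. *)
Definition pre_interp (x : 'rV[R]_3) : 'rV[R]_3 :=
  xget 0 [set y | exists alpha i (a : 'I_4 -> R),
    [/\ (tetra alpha i)° x,
        forall k, 0 <= a k <= 1,
        \sum_k a k = 1,
        x = \sum_k a k *: vertex alpha i k &
        y = \sum_k a k *: u (vertex alpha i k)]].

Definition interp (x : 'rV[R]_3) : 'rV[R]_3 :=
  pre_interp x - (L ^+ 3)^-1 *:
    \row_(l < 3) \int[leb3 R]_(p in @vec3 R @^-1` Omega)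
                   pre_interp (vec3 p) ord0 l.

Definition diffquot (alpha : {ffun 'I_3 -> 'I_n}) (i : 'I_5) : 'M[R]_3 :=
  \matrix_(l, k)
    ((u (vertex alpha i (lift ord_max k)) ord0 l
        - u (vertex alpha i ord_max) ord0 l)
     / frobenius (vertex alpha i (lift ord_max k) - vertex alpha i ord_max)).

(* Squared L^2 norm of the constant function diffquot alpha i on the
   tetrahedron. *)
Definition diffquot_L2sq (alpha : {ffun 'I_3 -> 'I_n}) (i : 'I_5) : \bar R :=
  (leb3 R (@vec3 R @^-1` tetra alpha i)
     * (\sum_l \sum_k `|diffquot alpha i l k| ^+ 2)%:E)%E.

End Subdivision.

Section Gradient.
Variable R : realType.

(* Entry (l, j) is the j-th partial derivative of the l-th component. *)
Definition grad (f : 'rV[R]_3 -> 'rV[R]_3) (x : 'rV[R]_3) : 'M[R]_3 :=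
  \matrix_(l, j) ('D_(delta_mx ord0 j) (fun y => f y ord0 l) x).

(* The integrals are over the interiors, where the piecewise gradient is
   defined. *)
Definition grad_L2sq (L : R) (n : nat) (f : 'rV[R]_3 -> 'rV[R]_3) : \bar R :=
  (\sum_(alpha : {ffun 'I_3 -> 'I_n}) \sum_(i < 5)
     \int[leb3 R]_(p in @vec3 R @^-1` (tetra L alpha i)°)
       (frobenius (grad f (vec3 p)) ^+ 2)%:E)%E.

End Gradient.

(* Main.v *)
Require Import Defs.
From mathcomp Require Import all_boot all_order all_algebra all_fingroup.
From mathcomp Require Import lra ring.
From mathcomp Require Import all_classical all_reals all_analysis.
From mathcomp Require Import measurable_realfun.
Set Implicit Arguments.
Unset Strict Implicit.
Unset Printing Implicit Defensive.
Import Order.TTheory GRing.Theory Num.Theory.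
Import numFieldNormedType.Exports.
Local Open Scope classical_set_scope.
Local Open Scope ring_scope.

(** On a fixed tetrahedron T with vertices v_1, ..., v_4 the barycentric
    coordinates of x are, for k = 1, 2, 3, the entries of M (x - v_4) divided by
    the edge lengths |w_k|, because M inverts the matrix of normalised edges.
    Interpolating the values u(v_k) with these weights gives
    u(v_4) + D M (x - v_4), where D is the matrix of difference quotients
    ([bary_interpolate]).  The interpolant is therefore affine with derivative
    D M near every interior point, and subtracting its mean does not change the
    derivative ([interp_grad]).

    For this formula to describe the interpolant, which is defined as the value
    selected by whichever tetrahedron has x in its interior, the interiors must
    be pairwise disjoint ([interior_tetra_disjoint]).  An interior point has
    positive barycentric coordinates, so its position inside its cube lies
    strictly between 0 and 1, which determines the cube; within a cube, the five
    reference tetrahedra are told apart by linear inequalities.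

    The gradient being constant on each interior, its squared L^2 norm is the
    sum of |T°| |D M|^2.  The boundary of T lies in the four planes where a
    barycentric coordinate vanishes, hence |T°| = |T| ([leb3_interior_tetra]).
    The two estimates then hold on each tetrahedron: |D M| <= ||M|| |D| for the
    Frobenius norm | | and the operator norm || ||
    ([frobenius_mulmx_le_opnorm]), and the same inequality applied to
    D = (D M) M^-1. *)

(** * Frobenius and operator norms *)

Section Norms.
Context {R : realType}.

Lemma cauchy_schwarz_sum (I : finType) (a b : I -> R) :
  (\sum_i a i * b i) ^+ 2 <= (\sum_i a i ^+ 2) * (\sum_i b i ^+ 2).
Proof.
(* Lagrange's identity. *)
have lagrange : \sum_i \sum_j (a i * b j - a j * b i) ^+ 2
    = (\sum_i a i ^+ 2) * (\sum_i b i ^+ 2) *+ 2 - (\sum_i a i * b i) ^+ 2 *+ 2.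
  transitivity (\sum_i \sum_j (a i ^+ 2 * b j ^+ 2)
      + \sum_i \sum_j (b i ^+ 2 * a j ^+ 2)
      - (\sum_i \sum_j (a i * b i) * (a j * b j)) *+ 2).
    rewrite -sumrMnl -big_split -sumrB /=; apply: eq_bigr => i _.
    rewrite -sumrMnl -big_split -sumrB /=; apply: eq_bigr => j _; ring.
  by rewrite -!big_distrlr /= [X in _ + X - _]mulrC -mulr2n expr2.
have : 0 <= \sum_i \sum_j (a i * b j - a j * b i) ^+ 2.
  by apply: sumr_ge0 => i _; apply: sumr_ge0 => j _; exact: sqr_ge0.
by rewrite lagrange subr_ge0 ler_pMn2r.
Qed.

Lemma frobenius_ge0 m n (A : 'M[R]_(m, n)) : 0 <= frobenius A.
Proof. exact: sqrtr_ge0. Qed.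

Lemma frobenius_sqr m n (A : 'M[R]_(m, n)) :
  frobenius A ^+ 2 = \sum_i \sum_j A i j ^+ 2.
Proof.
by rewrite sqr_sqrtr // !sumr_ge0 // => i _; rewrite sumr_ge0 // => j _;
  exact: sqr_ge0.
Qed.

Lemma frobenius_sqr_col n (x : 'cV[R]_n) :
  frobenius x ^+ 2 = \sum_i x i ord0 ^+ 2.
Proof. by rewrite frobenius_sqr; apply: eq_bigr => i _; rewrite big_ord1. Qed.

Lemma frobenius_eq0 m n (A : 'M[R]_(m, n)) : (frobenius A == 0) = (A == 0).
Proof.
apply/eqP/eqP => [A0|->]; last first.
  by rewrite /frobenius big1 ?sqrtr0 // => i _; rewrite big1 // => j _;
    rewrite mxE expr0n.
have sq0 : \sum_i \sum_j A i j ^+ 2 = 0 by rewrite -frobenius_sqr A0 expr0n.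
apply/matrixP => i j; rewrite mxE; apply/eqP; rewrite -sqrf_eq0; apply/eqP.
have row0 :=
  psumr_eq0P (fun i _ => sumr_ge0 _ (fun j _ => sqr_ge0 (A i j))) sq0.
exact: (psumr_eq0P (fun j _ => sqr_ge0 (A i j)) (row0 i isT)).
Qed.

Lemma frobenius0 m n : frobenius (0 : 'M[R]_(m, n)) = 0.
Proof. by apply/eqP; rewrite frobenius_eq0. Qed.

Lemma frobeniusZ m n c (A : 'M[R]_(m, n)) :
  frobenius (c *: A) = `|c| * frobenius A.
Proof.
apply/eqP; rewrite -(@eqrXn2 _ 2) ?mulr_ge0 ?frobenius_ge0 //; apply/eqP.
rewrite exprMn !frobenius_sqr mulr_sumr real_normK ?num_real //.
apply: eq_bigr => i _; rewrite mulr_sumr; apply: eq_bigr => j _.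
by rewrite mxE exprMn.
Qed.

Lemma frobenius_mul_col_le m n (A : 'M[R]_(m, n)) (x : 'cV[R]_n) :
  frobenius (A *m x) <= frobenius A * frobenius x.
Proof.
rewrite -(@ler_pXn2r _ 2) ?nnegrE ?mulr_ge0 ?frobenius_ge0 //.
rewrite exprMn !frobenius_sqr_col frobenius_sqr mulr_suml.
apply: ler_sum => i _; rewrite mxE; exact: cauchy_schwarz_sum.
Qed.

(** Without this bound the supremum defining [opnorm] would be a default
    value. *)
Lemma opnorm_ubound m n (A : 'M[R]_(m, n)) :
  has_ubound [set frobenius (A *m x) |
    x in [set x : 'cV[R]_n | frobenius x <= 1]].
Proof.
exists (frobenius A) => _ [x /= x_le1 <-].
apply: (le_trans (frobenius_mul_col_le A x)).
by rewrite ler_piMr ?frobenius_ge0.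
Qed.

Lemma frobenius_mul_col_le_opnorm m n (A : 'M[R]_(m, n)) (x : 'cV[R]_n) :
  frobenius (A *m x) <= opnorm A * frobenius x.
Proof.
have [->|x0] := eqVneq x 0.
  by rewrite mulmx0 !frobenius0 mulr0.
have x_gt0 : 0 < frobenius x.
  by rewrite lt_neqAle frobenius_ge0 eq_sym frobenius_eq0 x0.
rewrite -ler_pdivrMr // mulrC -[X in X * _]gtr0_norm ?invr_gt0 //.
rewrite -frobeniusZ scalemxAr; apply: ub_le_sup (opnorm_ubound A) _ _.
exists ((frobenius x)^-1 *: x) => //=.
by rewrite frobeniusZ gtr0_norm ?invr_gt0 // mulVf ?gt_eqF.
Qed.

Lemma opnorm_ge0 m n (A : 'M[R]_(m, n)) : 0 <= opnorm A.
Proof.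
apply: le_trans (frobenius_ge0 (A *m 0)) _.
apply: ub_le_sup (opnorm_ubound A) _ _.
by exists 0 => //=; rewrite frobenius0.
Qed.

(** A matrix and its transpose have the same operator norm; this is the
    inequality needed, because the rows of [D *m A] are the transposes of [A^T]
    applied to the rows of [D].  With v = A^T x,
    |v|^2 = <x, A v> <= |x| |A v| <= opnorm A |x| |v|. *)
Lemma frobenius_mul_tr_le_opnorm m n (A : 'M[R]_(m, n)) (x : 'cV[R]_m) :
  frobenius (A^T *m x) <= opnorm A * frobenius x.
Proof.
set v := A^T *m x; have [v0|v_neq0] := eqVneq (frobenius v) 0.
  by rewrite v0 mulr_ge0 ?frobenius_ge0 // opnorm_ge0.
have v_gt0 : 0 < frobenius v by rewrite lt_neqAle eq_sym v_neq0 frobenius_ge0.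
have vvE : frobenius v ^+ 2 = \sum_i x i ord0 * (A *m v) i ord0.
  rewrite frobenius_sqr_col.
  transitivity (\sum_j \sum_i x i ord0 * (A i j * v j ord0)).
    apply: eq_bigr => j _; rewrite expr2 {1}/v mxE mulr_suml.
    by apply: eq_bigr => i _; rewrite mxE; ring.
  rewrite exchange_big; apply: eq_bigr => i _.
  by rewrite [in RHS]mxE mulr_sumr.
have vv_le : frobenius v ^+ 2 <= frobenius x * frobenius (A *m v).
  rewrite -(@ler_pXn2r _ 2) ?nnegrE ?exprn_ge0 ?mulr_ge0 //
      ?frobenius_ge0 //.
  rewrite {1}vvE exprMn !frobenius_sqr_col; exact: cauchy_schwarz_sum.
rewrite -(ler_pM2r v_gt0) -expr2 (le_trans vv_le) // mulrAC.
by rewrite [leRHS]mulrC ler_wpM2l ?frobenius_ge0 // frobenius_mul_col_le_opnorm.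
Qed.

Lemma frobenius_mulmx_le_opnorm p m n (D : 'M[R]_(p, m)) (A : 'M[R]_(m, n)) :
  frobenius (D *m A) ^+ 2 <= opnorm A ^+ 2 * frobenius D ^+ 2.
Proof.
rewrite !frobenius_sqr mulr_sumr; apply: ler_sum => i _.
have rowE q (B : 'M[R]_(p, q)) :
    \sum_j B i j ^+ 2 = frobenius (row i B)^T ^+ 2.
  by rewrite frobenius_sqr_col; apply: eq_bigr => j _; rewrite !mxE.
rewrite !rowE row_mul trmx_mul -exprMn.
rewrite lerXn2r ?nnegrE ?mulr_ge0 ?frobenius_ge0 ?opnorm_ge0 //.
exact: frobenius_mul_tr_le_opnorm.
Qed.

End Norms.

(** * Locally affine maps *)

Section Affine.
Context {R : realType}.

Lemma differentiable_mulmxr m n (A : 'M[R]_(m, n)) (x : 'rV[R]_m) :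
  differentiable (mulmxr A : 'rV[R]_m -> 'rV[R]_n) x.
Proof.
rewrite (_ : (mulmxr A : 'rV[R]_m -> 'rV[R]_n)
    = \sum_(i < m) (fun y : 'rV[R]_m => y ord0 i *: row i A)); last first.
  by apply/funext => y; rewrite fct_sumE /= mulmx_sum_row.
apply: differentiable_sum => i.
by apply: differentiableZl; exact: differentiable_coord.
Qed.

(** Since [f] agrees with the affine map only near [x], the remainder of its
    first-order expansion is a function that vanishes near 0, which is enough for
    it to be negligible. *)
Lemma near_affine_diff m n (f : 'rV[R]_m -> 'rV[R]_n) (A : 'M[R]_(m, n))
    (c : 'rV[R]_n) (x : 'rV[R]_m) :
    (\forall y \near x, f y = c + y *m A) ->
  differentiable f x /\ 'd f x = mulmxr A :> ('rV[R]_m -> 'rV[R]_n).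
Proof.
move=> fA.
have ctsA : continuous (mulmxr A : 'rV[R]_m -> 'rV[R]_n).
  by move=> y; exact: differentiable_continuous (differentiable_mulmxr _ _).
have expansion : f \o shift x
    = cst (f x) + (mulmxr A : 'rV[R]_m -> 'rV[R]_n) +o_ (0 : 'rV[R]_m) id.
  apply/eqaddoP => _/posnumP[e].
  have fx := nbhs_singleton fA.
  have fxA : \forall h \near (0 : 'rV[R]_m), f (h + x) = c + (h + x) *m A.
    by move: fA; rewrite (near_shift 0 x) /= subr0.
  near=> h; rewrite [X in `|X|](_ : _ = 0) ?normr0 ?mulr_ge0 //.
  rewrite /= [_ h]/(f (h + x) - (f x + h *m A)) fx (near fxA h) // mulmxDl.
  by rewrite addrA (addrAC c); exact: subrr.
have dfE : 'd f x = mulmxr A :> ('rV[R]_m -> 'rV[R]_n) by exact: diff_unique.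
by split=> //; apply/diff_locallyP; rewrite dfE.
Unshelve. all: by end_near. Qed.

Lemma near_affine_grad (f : 'rV[R]_3 -> 'rV[R]_3) (A : 'M[R]_3)
    (c x : 'rV[R]_3) :
    (\forall y \near x, f y = c + y *m A) ->
  differentiable f x /\ grad f x = A^T.
Proof.
move=> fA; have [df dfE] := near_affine_diff fA; split=> //.
apply/matrixP => l j; rewrite !mxE.
have := derive_mx (diff_derivable (v := delta_mx ord0 j) df).
move=> /matrixP/(_ ord0 l); rewrite !mxE => <-.
by rewrite deriveE // dfE /= -rowE mxE.
Qed.

End Affine.

(** * Planes are null sets *)

Section Planes.
Context {R : realType}.

Definition affine (c : R) (g : 'I_3 -> R) (x : 'rV[R]_3) : R :=
  c + \sum_j x ord0 j * g j.

Lemma continuous_affine c g : continuous (affine c g).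
Proof.
have cts_sum : continuous (fun y : 'rV[R]_3 => \sum_j y ord0 j * g j).
  have := @continuous_big R 'I_3 +%R 0 xpredT (@add_continuous _) 'rV[R]_3
    (index_enum 'I_3) (fun j (y : 'rV[R]_3) => y ord0 j * g j).
  apply=> j _ y; have yj : z ord0 j @[z --> y] --> y ord0 j.
    exact: coord_continuous.
  exact: cvgM yj (cvg_cst (g j)).
by move=> x; exact: cvgD (cvg_cst c) (cts_sum x).
Qed.

Lemma measurable_vec3 j : measurable_fun [set: R3 R]
  (fun p => vec3 p ord0 j : measurableTypeR R).
Proof.
case: j => -[|[|[|//]]] jlt; under eq_fun do rewrite mxE /=.
- by apply: measurableT_comp => //; exact: measurable_fst.
- by apply: measurableT_comp measurable_snd _ => //; exact: measurable_fst.
- exact: measurable_snd.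
Qed.

Lemma measurable_affine c g : measurable_fun [set: R3 R]
  (fun p => affine c g (vec3 p) : measurableTypeR R).
Proof.
apply: measurable_funD => //; apply: measurable_sum => j.
by apply: measurable_funM => //; exact: measurable_vec3.
Qed.

Lemma measurable_zeros d (T : measurableType d) (f : T -> measurableTypeR R) :
  measurable_fun setT f -> measurable [set x | f x = 0].
Proof.
by move=> mf; have := mf measurableT _ (measurable_set1 0); rewrite setTI.
Qed.

Lemma lebesgue_measure_root (c a : R) : a != 0 ->
  lebesgue_measure [set x : R | c + x * a = 0] = 0%E.
Proof.
move=> a0; rewrite (_ : mkset _ = [set - c / a]) ?lebesgue_measure_set1 //.
apply/seteqP; split=> x /=.
  by move/eqP; rewrite addrC addr_eq0 => /eqP <-; rewrite mulfK.
by move=> ->; rewrite divfK // addrN.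
Qed.

(** Every section of the set is a single point, which is null. *)
Lemma product_graph_null d (T : measurableType d)
    (mu : {measure set T -> \bar R}) (f : T -> R) (a : R) : a != 0 ->
  (mu \x @lebesgue_measure R)%E [set p | f p.1 + p.2 * a = 0] = 0%E.
Proof.
move=> a0; apply: integral0_eq => x _ /=.
rewrite -[RHS](lebesgue_measure_root (f x) a0); congr lebesgue_measure.
by apply/seteqP; split=> y /=; rewrite /xsection /= inE.
Qed.

(** When the last coefficient of [g] that is not 0 is the third, the plane is a
    graph over the first two coordinates; otherwise it is the product of a null
    line or a null point with the remaining coordinate axes. *)
Lemma leb3_plane c g : (exists j, g j != 0) ->
  leb3 R (@vec3 R @^-1` [set x | affine c g x = 0]) = 0%E.
Proof.
move=> g_neq0.
rewrite (_ : _ @^-1` _ = [set p : R3 R | c + p.1.1 * g ord0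
   + p.1.2 * g (lift ord0 ord0) + p.2 * g (lift ord0 (lift ord0 ord0)) = 0]);
  last first.
  by apply/seteqP; split=> p /=; rewrite /affine !big_ord_recl big_ord0 !mxE /=
    addr0 !addrA.
have [g2|g2] := eqVneq (g (lift ord0 (lift ord0 ord0))) 0; last first.
  rewrite /leb3.
  have := @product_graph_null _ (measurableTypeR R * measurableTypeR R)%type
    (@lebesgue_measure R \x @lebesgue_measure R)%E
    (fun p : measurableTypeR R * measurableTypeR R =>
      c + p.1 * g ord0 + p.2 * g (lift ord0 ord0)) _ g2.
  exact.
rewrite g2.
have mT := @measurableT _ (measurableTypeR R).
have [g1|g1] := eqVneq (g (lift ord0 ord0)) 0; last first.
  rewrite (_ : mkset _ = [set p : R * R |
    c + p.1 * g ord0 + p.2 * g (lift ord0 ord0) = 0] `*` setT); last first.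
    apply/seteqP; split=> p /=; rewrite mulr0 addr0; first by split.
    by case.
  have line0 := @product_graph_null _ (measurableTypeR R) (@lebesgue_measure R)
    (fun x : measurableTypeR R => c + x * g ord0) _ g1.
  rewrite [LHS]product_measure1E //; last first.
    apply: (measurable_zeros (f := fun p : measurableTypeR R * measurableTypeR R
      => c + p.1 * g ord0 + p.2 * g (lift ord0 ord0))).
    apply: measurable_funD; last by apply: measurable_funM.
    by apply: measurable_funD => //; apply: measurable_funM.
  by rewrite [X in (X * _)%E]line0 mul0e.
have g0 : g ord0 != 0.
  apply/negP => /eqP g0; case: g_neq0 => -[[|[|[|//]]] j_lt] /eqP; apply;
    [rewrite -[RHS]g0|rewrite -[RHS]g1|rewrite -[RHS]g2];
    by congr g; exact: val_inj.
rewrite g1.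
rewrite (_ : mkset _ = ([set x : R | c + x * g ord0 = 0] `*` setT) `*` setT);
  last first.
  by apply/seteqP; split=> p /=; rewrite !mulr0 !addr0 => // -[[]].
have mS : measurable [set x : R | c + x * g ord0 = 0].
  apply: measurable_zeros.
  by apply: measurable_funD => //; apply: measurable_funM.
rewrite [LHS]product_measure1E //; last exact: measurableX.
rewrite [X in (X * _)%E]product_measure1E //.
have point0 := lebesgue_measure_root c g0.
by rewrite [X in (X * _ * _)%E]point0 !mul0e.
Qed.

End Planes.

(** * The five reference tetrahedra *)

Section Reference.
Context {R : realType}.

Lemma ref_coordsE (i : 'I_5) (a : 'I_4 -> R) (j : 'I_3) :
  (\sum_m a m *: ref_vertex R i m) ord0 j =
  \sum_m a m * (nth 0 (nth [::] (nth [::] ref_table i) m) j)%N%:R.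
Proof. by rewrite summxE; apply: eq_bigr => m _; rewrite !mxE. Qed.

Lemma ref_coords_itv (i : 'I_5) (a : 'I_4 -> R) (j : 'I_3) :
    (forall m, 0 < a m) -> \sum_m a m = 1 ->
  0 < (\sum_m a m *: ref_vertex R i m) ord0 j < 1.
Proof.
move=> a_gt0; rewrite ref_coordsE.
have := (a_gt0 ord0, a_gt0 (lift ord0 ord0), a_gt0 (lift ord0 (lift ord0 ord0)),
  a_gt0 (lift ord0 (lift ord0 (lift ord0 ord0)))).
rewrite !big_ord_recl !big_ord0.
case: i => -[|[|[|[|[|//]]]]] i_lt; case: j => -[|[|[|//]]] j_lt;
  rewrite /ref_table /=;
  move=> [[[a0 a1] a2] a3] a_sum; apply/andP; split; lra.
Qed.

(** Separating inequalities: S_2, ..., S_5 lie in the half-space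
    z_1 + z_2 + z_3 >= 1 and S_1 in the opposite one; S_3, S_4, S_5 are cut off
    by z_1 + z_2 - z_3 >= 1, z_1 + z_3 - z_2 >= 1 and z_2 + z_3 - z_1 >= 1.
    For each pair of tetrahedra, linear arithmetic finds the contradiction in
    the coordinates themselves. *)
Lemma ref_coords_disjoint (i i' : 'I_5) (a b : 'I_4 -> R) :
    (forall m, 0 < a m) -> \sum_m a m = 1 ->
    (forall m, 0 < b m) -> \sum_m b m = 1 ->
    \sum_m a m *: ref_vertex R i m = \sum_m b m *: ref_vertex R i' m ->
  i = i'.
Proof.
move=> a_gt0 + b_gt0 + /matrixP ab.
have := (a_gt0 ord0, a_gt0 (lift ord0 ord0), a_gt0 (lift ord0 (lift ord0 ord0)),
  a_gt0 (lift ord0 (lift ord0 (lift ord0 ord0)))).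
have := (b_gt0 ord0, b_gt0 (lift ord0 ord0), b_gt0 (lift ord0 (lift ord0 ord0)),
  b_gt0 (lift ord0 (lift ord0 (lift ord0 ord0)))).
have := (ab ord0 (inord 0), ab ord0 (inord 1), ab ord0 (inord 2)).
rewrite !ref_coordsE !big_ord_recl !big_ord0 !inordK //.
case: i ab => -[|[|[|[|[|//]]]]] i_lt _;
  case: i' => -[|[|[|[|[|//]]]]] i'_lt;
  try (by move=> *; exact: val_inj);
  rewrite /ref_table /=;
  move=> [[x0 x1] x2] [[[b0 b1] b2] b3] [[[a0 a1] a2] a3] a_sum b_sum;
  exfalso; lra.
Qed.

End Reference.

(** * Barycentric coordinates *)

Section Barycentric.
Context {R : realType}.
Variables (L : R) (n : nat) (s : 'I_5 -> {perm 'I_4}).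
Hypotheses (L_gt0 : 0 < L) (n_gt0 : (0 < n)%N).
Implicit Types (alpha : {ffun 'I_3 -> 'I_n}) (i : 'I_5).

Let v alpha i k : 'rV[R]_3 := vertex L s alpha i k.
Let w i k : 'rV[R]_3 := edge L n s i k.
Let M i : 'M[R]_3 := Mmx L n s i.

(** Row [k] of the linear part of the barycentric coordinates.  The last row
    makes the four rows sum to 0, since the coordinates sum to 1. *)
Definition bary_grad i (k : 'I_4) (l : 'I_3) : R :=
  if unlift ord_max k is Some j then M i j l / frobenius (w i j)
  else - \sum_j M i j l / frobenius (w i j).

(** The constant is chosen so that the last coordinate is 1, and the others 0,
    at the fourth vertex.  In this expanded form the coordinate is visibly affine
    in [x], hence continuous and measurable. *)
Definition bary alpha i (k : 'I_4) : 'rV[R]_3 -> R :=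
  affine ((k == ord_max)%:R - \sum_l v alpha i ord_max ord0 l * bary_grad i k l)
    (bary_grad i k).

Lemma baryE alpha i k x : bary alpha i k x = (k == ord_max)%:R
  + \sum_l (x ord0 l - v alpha i ord_max ord0 l) * bary_grad i k l.
Proof.
rewrite /bary /affine -addrA; congr (_ + _).
by rewrite addrC -sumrB; apply: eq_bigr => l _; rewrite -mulrBl.
Qed.

Lemma bary_lift alpha i j x :
  bary alpha i (lift ord_max j) x
    = (M i *m (x - v alpha i ord_max)^T) j ord0 / frobenius (w i j).
Proof.
rewrite baryE eq_sym (negbTE (neq_lift _ _)) add0r /bary_grad liftK !mxE.
rewrite mulr_suml; apply: eq_bigr => l _.
by rewrite !mxE mulrCA mulrA.
Qed.

Lemma sum_bary alpha i x : \sum_k bary alpha i k x = 1.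
Proof.
rewrite (bigD1_ord ord_max) //= baryE eqxx -addrA -[RHS]addr0.
congr (_ + _).
under [X in _ + X = _]eq_bigr do
  rewrite baryE eq_sym (negbTE (neq_lift _ _)) add0r.
rewrite exchange_big -big_split big1 //= => l _.
rewrite -mulr_sumr -mulrDr /bary_grad unlift_none.
by under [X in _ * (_ + X)]eq_bigr do rewrite liftK; rewrite addNr mulr0.
Qed.

Lemma unit_edges_unit i : unit_edges L n s i \in unitmx.
Proof.
by have /esym/mulmx1_unit[] := mul_unit_edges_Mmx s L_gt0 n_gt0 i.
Qed.

(** Otherwise column [k] of the invertible matrix [unit_edges] would be 0, the
    inverse of 0 being 0. *)
Lemma edge_length_neq0 i k : frobenius (w i k) != 0.
Proof.
apply/eqP => w0; have /matrixP/(_ k k) := mulVmx (unit_edges_unit i).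
rewrite !mxE eqxx big1 => [/esym/eqP|l _]; first by rewrite oner_eq0.
by rewrite [unit_edges _ _ _ _ _ _]mxE [frobenius _]w0 invr0 !mulr0.
Qed.

Lemma sum_bary_scale (V : lmodType R) (f : 'I_4 -> V) alpha i x :
  \sum_k bary alpha i k x *: f k = f ord_max
    + \sum_j bary alpha i (lift ord_max j) x
        *: (f (lift ord_max j) - f ord_max).
Proof.
rewrite (bigD1_ord ord_max) //=.
have := sum_bary alpha i x; rewrite (bigD1_ord ord_max) //= => /eqP.
rewrite eq_sym -subr_eq => /eqP <-; rewrite scalerBl scale1r -addrA.
congr (_ + _).
rewrite scaler_suml addrC -sumrB.
by apply: eq_bigr => j _; rewrite scalerBr.
Qed.

Lemma bary_combination alpha i x : x = \sum_k bary alpha i k x *: v alpha i k.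
Proof.
rewrite sum_bary_scale -[LHS](subrKC (v alpha i ord_max)); congr (_ + _).
set y := x - _; apply: trmx_inj.
rewrite -[LHS]mul1mx (mul_unit_edges_Mmx s L_gt0 n_gt0 i) -mulmxA.
apply/colP => l; rewrite !mxE summxE; apply: eq_bigr => j _.
rewrite bary_lift edgeE [unit_edges _ _ _ _ _ _]mxE !mxE; ring.
Qed.

Lemma bary_unique alpha i (a : 'I_4 -> R) x :
    \sum_k a k = 1 -> x = \sum_k a k *: v alpha i k ->
  forall k, a k = bary alpha i k x.
Proof.
move=> a1 xE.
have a_lift j : a (lift ord_max j) = bary alpha i (lift ord_max j) x.
  have xvE : (x - v alpha i ord_max)^T = unit_edges L n s i *m
      \col_j (a (lift ord_max j) * frobenius (w i j)).
    have -> : x - v alpha i ord_max = \sum_j a (lift ord_max j) *: w i j.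
      rewrite -[v alpha i ord_max]scale1r -a1 xE scaler_suml -sumrB.
      rewrite (bigD1_ord ord_max) //= subrr add0r; apply: eq_bigr => k _.
      by rewrite -scalerBr edgeE.
    apply/colP => l; rewrite !mxE summxE; apply: eq_bigr => k _.
    rewrite [LHS]mxE [unit_edges _ _ _ _ _ _]mxE [(\col__ _) _ _]mxE.
    rewrite -/(w i k); by field; exact: edge_length_neq0.
  rewrite bary_lift xvE mulmxA mulVmx ?unit_edges_unit // mul1mx mxE.
  by rewrite mulfK // edge_length_neq0.
move=> k; case: (unliftP ord_max k) => [j ->|->] //.
have : \sum_k bary alpha i k x = \sum_k a k by rewrite sum_bary.
rewrite (bigD1_ord ord_max) //= [RHS](bigD1_ord ord_max) //=.
have -> : \sum_(j < 3) a (lift ord_max j)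
  = \sum_(j < 3) bary alpha i (lift ord_max j) x by exact: eq_bigr.
by move/addIr.
Qed.

Lemma bary_vertex alpha i k m : bary alpha i k (v alpha i m) = (k == m)%:R.
Proof.
apply/esym; apply: (bary_unique (a := fun k => (k == m)%:R)).
  by rewrite (bigD1 m) //= eqxx big1 ?addr0 // => j /negbTE ->.
rewrite (bigD1 m) //= eqxx scale1r big1 ?addr0 // => j /negbTE ->.
by rewrite scale0r.
Qed.

(** The coordinate is not constant: it is 1 at the vertex [k] and 0 at the
    others. *)
Lemma bary_grad_neq0 i k : exists l, bary_grad i k l != 0.
Proof.
pose alpha : {ffun 'I_3 -> 'I_n} := [ffun=> Ordinal n_gt0].
apply: contrapT => /forallNP g0.
have [m km] : exists m, k != m.
  by case: (eqVneq k ord0) => [->|k0]; [exists ord_max|exists ord0].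
have := bary_vertex alpha i k k; have := bary_vertex alpha i k m.
rewrite eqxx (negbTE km) /bary /affine.
have s0 (y : 'rV[R]_3) : \sum_l y ord0 l * bary_grad i k l = 0.
  apply: big1 => l _; move/negP: (g0 l); rewrite negbK => /eqP ->.
  by rewrite mulr0.
by rewrite !s0 => -> /esym/eqP; rewrite oner_eq0.
Qed.

(** Undoing the chosen ordering of the vertices: these are the weights on the
    vertices of the reference tetrahedron in their original order. *)
Lemma sum_bary_perm alpha i x :
  \sum_m bary alpha i ((s i)^-1%g m) x = 1.
Proof.
rewrite -[RHS](sum_bary alpha i x).
by rewrite [RHS](reindex_inj (@perm_inj _ (s i)^-1%g)).
Qed.

Lemma bary_ref alpha i x : x = corner L alpha
  + step L n *: \sum_m bary alpha i ((s i)^-1%g m) x *: ref_vertex R i m.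
Proof.
rewrite -[corner _ _]scale1r -(sum_bary_perm alpha i x) scaler_suml.
rewrite scaler_sumr -big_split {1}(bary_combination alpha i x).
rewrite (reindex_inj (@perm_inj _ (s i)^-1%g)) /=; apply: eq_bigr => m _.
by rewrite /v /vertex permKV scalerDr !scalerA mulrC.
Qed.

Lemma tetra_bary_ge0 alpha i :
  tetra L alpha i = [set x | forall k, 0 <= bary alpha i k x].
Proof.
apply/seteqP; split=> x /=.
  move=> [_ [a [a_ge0 a1 ->]] <-] k.
  rewrite -(bary_unique (a := fun k => a (s i k))) ?a_ge0 //.
    by rewrite -a1 [RHS](reindex_inj (@perm_inj _ (s i))).
  under [RHS]eq_bigr do rewrite /v /vertex scalerDr.
  rewrite big_split /= -scaler_suml (_ : \sum_k a (s i k) = 1); last first.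
    by rewrite -a1 [RHS](reindex_inj (@perm_inj _ (s i))).
  rewrite scale1r; congr (_ + _).
  rewrite (reindex_inj (@perm_inj _ (s i))) /= scaler_sumr.
  by apply: eq_bigr => m _; rewrite !scalerA mulrC.
move=> b_ge0; exists (\sum_m bary alpha i ((s i)^-1%g m) x *: ref_vertex R i m).
  exists (fun m => bary alpha i ((s i)^-1%g m) x); split=> //.
  exact: sum_bary_perm.
by rewrite -bary_ref.
Qed.

Lemma bary_extrapolate alpha i k x y t :
  bary alpha i k (x + t *: (x - y))
    = (1 + t) * bary alpha i k x - t * bary alpha i k y.
Proof.
rewrite /bary /affine.
have -> : \sum_l (x + t *: (x - y)) ord0 l * bary_grad i k l =
    (1 + t) * (\sum_l x ord0 l * bary_grad i k l)
    - t * (\sum_l y ord0 l * bary_grad i k l).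
  rewrite !mulr_sumr -sumrB; apply: eq_bigr => l _; rewrite !mxE; ring.
ring.
Qed.

(** If x is interior, then moving a little from x away from the vertex v_k stays
    in the tetrahedron: for some t > 0, x + t (x - v_k) has k-th coordinate
    (1 + t) b_k(x) - t >= 0, so b_k(x) > 0.  Conversely, positive coordinates
    remain positive near x. *)
Lemma interior_tetra_bary_gt0 alpha i :
  (tetra L alpha i)° = [set x | forall k, 0 < bary alpha i k x].
Proof.
apply/seteqP; split=> x.
  move=> Tx k.
  have cvgx : x + t *: (x - v alpha i k) @[t --> (0 : R)^'+] --> x.
    rewrite -[X in _ --> X]addr0 -(scale0r (x - v alpha i k)).
    have t_cvg : t @[t --> (0 : R)^'+] --> (0 : R).
      exact: cvg_within.
    exact: cvgD (cvg_cst x) (cvgZ t_cvg (cvg_cst (x - v alpha i k))).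
  near ((0 : R)^'+) => t.
  have t_gt0 : 0 < t by near: t; exact: nbhs_right_gt.
  have : tetra L alpha i (x + t *: (x - v alpha i k)).
    by near: t; exact: (cvgx _ Tx).
  rewrite tetra_bary_ge0 => /(_ k).
  rewrite bary_extrapolate bary_vertex eqxx mulr1 subr_ge0.
  move=> /(lt_le_trans t_gt0).
  by rewrite pmulr_rgt0 // addr_gt0.
move=> b_gt0; rewrite /interior /= tetra_bary_ge0.
apply: (@filter_forall _ _ (fun k => [set y | 0 <= bary alpha i k y]) _
  (nbhs_filter x)) => k.
have bx : bary alpha i k y @[y --> x] --> bary alpha i k x.
  exact: continuous_affine.
have b_near : \forall y \near x, 0 < bary alpha i k y.
  exact: (@cvgr_gt _ _ _ (nbhs_filter x) _ _ bx 0 (b_gt0 k)).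
by apply: (@filterS _ _ (nbhs_filter x) _ _ _ b_near) => y /ltW.
Unshelve. all: by end_near. Qed.

Lemma interior_tetra_coords alpha i x : (tetra L alpha i)° x ->
  exists a : 'I_4 -> R, [/\ forall m, 0 < a m, \sum_m a m = 1 &
    x = corner L alpha + step L n *: \sum_m a m *: ref_vertex R i m].
Proof.
rewrite interior_tetra_bary_gt0 => /= b_gt0.
exists (fun m => bary alpha i ((s i)^-1%g m) x); split.
- by move=> m; exact: b_gt0.
- exact: sum_bary_perm.
- exact: bary_ref.
Qed.

End Barycentric.

(** * Disjoint interiors and null boundaries *)

Section Subdivision.
Context {R : realType}.
Variables (L : R) (n : nat) (s : 'I_5 -> {perm 'I_4}).
Hypotheses (L_gt0 : 0 < L) (n_gt0 : (0 < n)%N).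
Implicit Types (alpha : {ffun 'I_3 -> 'I_n}) (i : 'I_5).

(** Dividing by the step, alpha + z = alpha' + z' where all coordinates of z and
    z' are strictly between 0 and 1. *)
Lemma interior_tetra_disjoint alpha alpha' i i' x :
  (tetra L alpha i)° x -> (tetra L alpha' i')° x -> alpha = alpha' /\ i = i'.
Proof.
have step_gt0 : 0 < step L n by rewrite divr_gt0 // ltr0n.
move=> /(interior_tetra_coords s L_gt0 n_gt0)[a [a_gt0 a1 ->]].
move=> /(interior_tetra_coords s L_gt0 n_gt0)[b [b_gt0 b1 /eqP]].
rewrite /corner -!scalerDr (inj_eq (scalerI (lt0r_neq0 step_gt0))) => /eqP ab.
have floor_le (p q : nat) (y z : R) :
    0 < y -> z < 1 -> p%:R + y = q%:R + z -> (p <= q)%N.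
  move=> y_gt0 z_lt1 pq; rewrite leqNgt; apply/negP => q_lt.
  have : q%:R + 1 <= p%:R :> R by rewrite natr1 ler_nat.
  by clear -y_gt0 z_lt1 pq; lra.
have alphaE : alpha = alpha'.
  apply/ffunP => j; apply: val_inj; have /matrixP/(_ ord0 j) := ab.
  have := ref_coords_itv i j a_gt0 a1; have := ref_coords_itv i' j b_gt0 b1.
  rewrite mxE [RHS]mxE ![(\row__ _) _ _]mxE.
  move=> /andP[zb_gt0 zb_lt1] /andP[za_gt0 za_lt1] eq_ab.
  by apply/eqP; rewrite eqn_leq (floor_le _ _ _ _ za_gt0 zb_lt1 eq_ab)
    (floor_le _ _ _ _ zb_gt0 za_lt1 (esym eq_ab)).
split=> //; move: ab; rewrite alphaE => /addrI.
exact: ref_coords_disjoint.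
Qed.

Lemma measurable_tetra alpha i : measurable (@vec3 R @^-1` tetra L alpha i).
Proof.
rewrite (tetra_bary_ge0 s L_gt0 n_gt0).
rewrite (_ : _ @^-1` _ = \bigcap_(k in [set: 'I_4])
    [set p : R3 R | 0 <= bary L s alpha i k (vec3 p)]); last first.
  by apply/seteqP; split=> p /= h k; [move=> _|]; exact: h.
apply: fin_bigcap_measurable => // k _.
rewrite -[X in measurable X]setTI.
exact: measurable_fun_le (measurable_cst _) (measurable_affine _ _).
Qed.

Lemma measurable_interior_tetra alpha i :
  measurable (@vec3 R @^-1` (tetra L alpha i)°).
Proof.
rewrite (interior_tetra_bary_gt0 s L_gt0 n_gt0).
rewrite (_ : _ @^-1` _ = \bigcap_(k in [set: 'I_4])
    [set p : R3 R | 0 < bary L s alpha i k (vec3 p)]); last first.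
  by apply/seteqP; split=> p /= h k; [move=> _|]; exact: h.
apply: fin_bigcap_measurable => // k _.
have mb : measurable_fun [set: R3 R]
    (fun p => bary L s alpha i k (vec3 p) : measurableTypeR R).
  exact: measurable_affine.
have := mb measurableT _ (measurable_itv `]0%R, +oo[).
rewrite setTI; congr measurable.
by apply/seteqP; split=> p /=; rewrite in_itv /= andbT.
Qed.

(** The difference is covered by the faces, which lie in planes. *)
Lemma leb3_interior_tetra alpha i :
  leb3 R (@vec3 R @^-1` (tetra L alpha i)°)
    = leb3 R (@vec3 R @^-1` tetra L alpha i).
Proof.
set F := @vec3 R @^-1` tetra L alpha i; set I := @vec3 R @^-1` _.
have mF : measurable F by exact: measurable_tetra.
have mI : measurable I by exact: measurable_interior_tetra.
have IF : I `<=` F by move=> p; exact: interior_subset.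
pose face (k : 'I_4) : set (R3 R) :=
  @vec3 R @^-1` [set x | bary L s alpha i k x = 0].
have mface k : measurable (face k).
  exact: measurable_zeros (measurable_affine _ _).
have face0 k : (leb3 R).-negligible (face k).
  apply/negligibleP => //; apply: leb3_plane.
  exact: bary_grad_neq0.
have bd0 : leb3 R (F `\` I) = 0%E.
  apply: measure_negligible; first exact: measurableD.
  apply: (@negligibleS _ _ _ _ (face ord0 `|` face (lift ord0 ord0) `|`
    face (lift ord0 (lift ord0 ord0)) `|` face ord_max)); last first.
    by do !apply: negligibleU.
  move=> p [Fp nIp]; move: Fp nIp; rewrite /F /I.
  rewrite (interior_tetra_bary_gt0 s L_gt0 n_gt0).
  rewrite (tetra_bary_ge0 s L_gt0 n_gt0) /= => Fp nIp.
  apply: contrapT => nface; apply: nIp => k.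
  rewrite lt_neqAle Fp andbT eq_sym; apply/eqP => pk; apply: nface.
  move: pk; case: k => -[|[|[|[|//]]]] k_lt pk;
    [left; left; left|left; left; right|left; right|right];
    rewrite /face /= -[RHS]pk; congr (bary _ _ _ _ _ _); exact: val_inj.
rewrite -[in RHS](setDUK IF); apply/esym; apply: measureU0 => //.
exact: measurableD.
Qed.

(** * The gradient of the interpolant *)

Variable u : 'rV[R]_3 -> 'rV[R]_3.

Lemma pre_interpE alpha i x : (tetra L alpha i)° x ->
  pre_interp L n s u x
    = \sum_k bary L s alpha i k x *: u (vertex L s alpha i k).
Proof.
move=> Tx; apply: xget_unique => /=.
  exists alpha, i, (fun k => bary L s alpha i k x).
  have b_ge0 k : 0 <= bary L s alpha i k x.
    move: (interior_subset Tx).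
    by rewrite (tetra_bary_ge0 s L_gt0 n_gt0); exact.
  have b1 := sum_bary L s alpha i x.
  split=> // [k|]; last exact: bary_combination.
  by rewrite b_ge0 -b1 (bigD1 k) //= lerDl sumr_ge0.
move=> y [alpha' [i' [a [Tx' _ a1 xE ->]]]].
have [-> ->] := interior_tetra_disjoint Tx Tx'.
by apply: eq_bigr => k _; rewrite (bary_unique L_gt0 n_gt0 a1 xE).
Qed.

(** Entry (l, k) of D is the increment of u_l along the k-th edge divided by the
    length of that edge, and the k-th coordinate carries the same length in its
    denominator: only the matrix M remains. *)
Lemma bary_interpolate alpha i x :
  \sum_k bary L s alpha i k x *: u (vertex L s alpha i k)
    = u (vertex L s alpha i ord_max) + (x - vertex L s alpha i ord_max)
        *m (diffquot L s u alpha i *m Mmx L n s i)^T.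
Proof.
rewrite (sum_bary_scale L s (fun k => u (vertex L s alpha i k))); congr (_ + _).
apply: trmx_inj; rewrite trmx_mul trmxK -mulmxA.
apply/colP => l; rewrite mxE summxE mxE; apply: eq_bigr => j _.
rewrite bary_lift [diffquot _ _ _ _ _ _ _]mxE edgeE [LHS]mxE.
set c := (_ *m _) j ord0; rewrite [X in _ * X]mxE [X in _ * (_ + X)]mxE.
ring.
Qed.

Lemma interp_grad alpha i x : (tetra L alpha i)° x ->
  differentiable (interp L n s u) x /\
  grad (interp L n s u) x = diffquot L s u alpha i *m Mmx L n s i.
Proof.
move=> Tx; set A := _ *m _; rewrite -[A]trmxK.
apply: (@near_affine_grad _ _ _ (u (vertex L s alpha i ord_max)
  - vertex L s alpha i ord_max *m A^T - (L ^+ 3)^-1 *: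
    \row_(l < 3) \int[leb3 R]_(p in @vec3 R @^-1` @Omega R L)
                   pre_interp L n s u (vec3 p) ord0 l)).
near=> y; have Ty : (tetra L alpha i)° y.
  by near: y; apply: open_nbhs_nbhs; split=> //; exact: open_interior.
rewrite /interp (pre_interpE Ty) bary_interpolate -/A mulmxBl.
by rewrite [RHS]addrAC; congr (_ - _); rewrite addrA addrAC.
Unshelve. all: by end_near. Qed.

(** * The two estimates *)

Lemma grad_L2sqE : grad_L2sq L n (interp L n s u) =
  (\sum_(alpha : {ffun 'I_3 -> 'I_n}) \sum_(i < 5)
     leb3 R (@vec3 R @^-1` tetra L alpha i) *
     (frobenius (diffquot L s u alpha i *m Mmx L n s i) ^+ 2)%:E)%E.
Proof.
apply: eq_bigr => alpha _; apply: eq_bigr => i _.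
rewrite -leb3_interior_tetra muleC -integral_cst; last first.
  exact: measurable_interior_tetra.
apply: eq_integral => p; rewrite inE /= => Tp.
by have [_ ->] := interp_grad Tp.
Qed.

Lemma diffquot_L2sqE alpha i : diffquot_L2sq L s u alpha i =
  (leb3 R (@vec3 R @^-1` tetra L alpha i) *
     (frobenius (diffquot L s u alpha i) ^+ 2)%:E)%E.
Proof.
rewrite /diffquot_L2sq frobenius_sqr; congr (_ * _%:E)%E.
by apply: eq_bigr => l _; apply: eq_bigr => k _; rewrite real_normK ?num_real.
Qed.

Lemma Mmx_unit i : Mmx L n s i \in unitmx.
Proof. by rewrite unitmx_inv unit_edges_unit. Qed.

Lemma grad_L2sq_le : (grad_L2sq L n (interp L n s u) <=
  (M_Linfty L n s ^+ 2)%:E * (\sum_(alpha : {ffun 'I_3 -> 'I_n}) \sum_(i < 5)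
          diffquot_L2sq L s u alpha i))%E.
Proof.
have D_ge0 alpha i : (0 <= diffquot_L2sq L s u alpha i)%E.
  by rewrite diffquot_L2sqE mule_ge0 // lee_fin sqr_ge0.
rewrite grad_L2sqE ge0_sume_distrr => [|alpha _]; last exact: sume_ge0.
apply: lee_sum => alpha _; rewrite ge0_sume_distrr //.
apply: lee_sum => i _; rewrite diffquot_L2sqE muleCA lee_wpmul2l //.
rewrite -EFinM lee_fin (le_trans (frobenius_mulmx_le_opnorm _ _)) //.
rewrite ler_wpM2r ?sqr_ge0 // ler_pXn2r ?nnegrE ?opnorm_ge0 //.
  exact: le_bigmax.
by apply: (le_trans (opnorm_ge0 (Mmx L n s i))); exact: le_bigmax.
Qed.

Lemma grad_L2sq_ge : ((Minv_Linfty L n s ^- 2)%:E *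
    (\sum_(alpha : {ffun 'I_3 -> 'I_n}) \sum_(i < 5)
          diffquot_L2sq L s u alpha i)
  <= grad_L2sq L n (interp L n s u))%E.
Proof.
have D_ge0 alpha i : (0 <= diffquot_L2sq L s u alpha i)%E.
  by rewrite diffquot_L2sqE mule_ge0 // lee_fin sqr_ge0.
rewrite grad_L2sqE ge0_sume_distrr => [|alpha _]; last exact: sume_ge0.
apply: lee_sum => alpha _; rewrite ge0_sume_distrr //.
apply: lee_sum => i _; rewrite diffquot_L2sqE muleCA lee_wpmul2l //.
rewrite -EFinM lee_fin.
set D := diffquot _ _ _ _ _; set m := Minv_Linfty _ _ _.
have m_ge : opnorm (invmx (Mmx L n s i)) <= m by exact: le_bigmax.
have m_ge0 : 0 <= m by apply: le_trans m_ge; exact: opnorm_ge0.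
(* The inverse of 0 is 0, which makes the lower bound 0. *)
have [->|m_neq0] := eqVneq m 0.
  by rewrite expr0n invr0 mul0r sqr_ge0.
have m2_gt0 : 0 < m ^+ 2 by rewrite exprn_gt0 // lt_neqAle eq_sym m_neq0.
rewrite ler_pdivrMl //.
rewrite -[D in leLHS](mulmxK (Mmx_unit i)).
apply: le_trans (frobenius_mulmx_le_opnorm _ _) _.
by rewrite ler_wpM2r ?sqr_ge0 // ler_pXn2r ?nnegrE ?opnorm_ge0.
Qed.

End Subdivision.

Theorem mainTheorem2 (R : realType) (L : R) (n : nat)
    (s : 'I_5 -> {perm 'I_4}) (u : 'rV[R]_3 -> 'rV[R]_3)
    (L_gt0 : 0 < L) (n_gt0 : (0 < n)%N)
    (u_cont : continuous u)
    (u_per : forall (x : 'rV[R]_3) (j : 'I_3),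
        u (x + L *: delta_mx ord0 j) = u x) :
  (forall (alpha : {ffun 'I_3 -> 'I_n}) (i : 'I_5) (x : 'rV[R]_3),
      (tetra L alpha i)° x ->
      differentiable (interp L n s u) x /\
      grad (interp L n s u) x = diffquot L s u alpha i *m Mmx L n s i) /\
  ((Minv_Linfty L n s ^- 2)%:E
     * (\sum_(alpha : {ffun 'I_3 -> 'I_n}) \sum_(i < 5)
          diffquot_L2sq L s u alpha i)
   <= grad_L2sq L n (interp L n s u)
   <= (M_Linfty L n s ^+ 2)%:E
     * (\sum_(alpha : {ffun 'I_3 -> 'I_n}) \sum_(i < 5)
          diffquot_L2sq L s u alpha i))%E.
Proof.
split; first by move=> alpha i x; exact: interp_grad.
by apply/andP; split; [exact: grad_L2sq_ge|exact: grad_L2sq_le].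
Qed.
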